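(* Let $\{K_{ij}\}_{i,j\in I}$ be a time-scaled intertwining cocycle with scaling factors $\{\lambda_{ij}\}_{i,j\in I}$, $\lambda_{ij}>0$, for the semigroups $\mathcal S_i(t)=e^{-tA_i}$. Then each $K_{ij}$ is boundedly invertible, and there exist $\tau_i>0$ ($i\in I$) such that for all $i,j\in I$, $$\sigma(\tau_iA_i)=\sigma(\tau_jA_j).$$ (That is, all generators belong to a common scaled isospectral class.)
   Context: Setting. $I$ is an index set. For each $i\in I$: $\mathcal H_i$ is a separable complex Hilbert space; $A_i$ is a positive (i.e. $\langle A_iu,u\rangle\ge 0$ for $u\in\mathrm{Dom}(A_i)$) self-adjoint operator on $\mathcal H_i$ with compact resolvent; $\mathcal S_i(t)=e^{-tA_i}$, $t\ge0$, is the associated strongly continuous contraction semigroup. Each sector is nontrivial: $\sigma(A_i)$ contains at least one strictly positive eigenvalue. Definition. A family of bounded injective operators $K_{ij}:\mathcal H_j\to\mathcal H_i$ ($i,j\in I$) is a time-scaled intertwining cocycle with scaling factors $\lambda_{ij}>0$ if for all $i,j,k\in I$: $K_{ik}=K_{ij}K_{jk}$, and $K_{ij}\mathcal S_j(t)=\mathcal S_i(\lambda_{ij}t)K_{ij}$ for all $t\ge0$. *)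

(* Defs.v *)
From HB Require Import structures.
From mathcomp Require Import all_boot all_order all_algebra.
From mathcomp Require Import all_classical all_reals all_analysis.
From mathcomp Require Export complex.

Set Implicit Arguments.
Unset Strict Implicit.
Unset Printing Implicit Defensive.

Import Order.TTheory GRing.Theory Num.Theory.
Import numFieldNormedType.Exports.

Local Open Scope classical_set_scope.
Local Open Scope complex_scope.
Local Open Scope ring_scope.

(* The form [inner] is linear in its first argument and conjugate-linear in the
   second one. The norm of a normed module over R[i] takes its values in R[i]
   (in fact in the nonnegative reals). *)
HB.mixin Record NormedModule_isHilbert (R : realType) V
    of CompleteNormedModule R[i] V := {
  inner : {dot V for (@Num.conj R[i])} ;
  inner_norm : forall u : V, (inner : V -> V -> R[i]) u u = `|u| ^+ 2
}.

#[short(type="hilbertType")]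
HB.structure Definition Hilbert (R : realType) :=
  { V of NormedModule_isHilbert R V & CompleteNormedModule R[i] V }.

Definition separable (T : topologicalType) : Prop :=
  exists2 D : set T, countable D & dense D.

Section BoundedOperators.
Variable R : realType.

Definition bounded_operator (V W : normedModType R[i]) (T : V -> W) : Prop :=
  exists M : R, forall u, `|T u| <= M%:C * `|u|.

Definition boundedly_invertible (V W : normedModType R[i])
    (T : {linear V -> W}) : Prop :=
  exists T' : {linear W -> V},
    [/\ bounded_operator T', cancel T T' & cancel T' T].

Definition compact_operator (V W : normedModType R[i])
    (T : {linear V -> W}) : Prop :=
  forall B : set V, bounded_set B -> precompact (T @` B).

End BoundedOperators.

(* A possibly unbounded operator A on V is a function which is linear on the
   subspace [dom A]; its values outside [dom A] carry no information. *)
Record operator (K : numFieldType) (V : lmodType K) := Operator {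
  dom : set V ;
  op_fun :> V -> V ;
  dom0 : dom 0 ;
  dom_linear : forall a u v, dom u -> dom v -> dom (a *: u + v) ;
  op_linear : forall a u v, dom u -> dom v ->
    op_fun (a *: u + v) = a *: op_fun u + op_fun v
}.

Section ScaleOperator.
Variables (K : numFieldType) (V : lmodType K) (c : K) (A : operator V).

Lemma scale_op_subproof a u v : dom A u -> dom A v ->
  c *: A (a *: u + v) = a *: (c *: A u) + c *: A v.
Proof.
by move=> Au Av; rewrite op_linear// scalerDr !scalerA (mulrC c a).
Qed.

Definition scale_op : operator V :=
  Operator (dom0 A) (@dom_linear _ _ A) scale_op_subproof.

End ScaleOperator.

Section Spectrum.
Variables (R : realType) (V : normedModType R[i]).
Implicit Types (A : operator V) (z : R[i]).

Definition is_resolvent A z (T : {linear V -> V}) : Prop :=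
  [/\ bounded_operator T,
      forall u, dom A u -> T (z *: u - A u) = u &
      forall v, dom A (T v) /\ z *: T v - A (T v) = v].

Definition resolvent_set A : set R[i] :=
  [set z | exists T : {linear V -> V}, is_resolvent A z T].

Definition spectrum A : set R[i] := ~` resolvent_set A.

Definition has_compact_resolvent A : Prop :=
  exists z (T : {linear V -> V}), is_resolvent A z T /\ compact_operator T.

Definition op_eigenvalue A z : Prop :=
  exists u, [/\ dom A u, u != 0 & A u = z *: u].

End Spectrum.

Section SelfAdjoint.
Variables (R : realType) (H : hilbertType R).
Implicit Type A : operator H.

(* The pair (v, w) lies in the graph of the adjoint of A. *)
Definition adjoint_graph A (v w : H) : Prop :=
  forall u, dom A u -> inner (A u) v = inner u w.

Definition self_adjoint A : Prop :=
  dense (dom A) /\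
  forall v w, (dom A v /\ A v = w) <-> adjoint_graph A v w.

(* In the order of R[i], 0 <= z means that z is real and nonnegative. *)
Definition positive_op A : Prop := forall u, dom A u -> 0 <= inner (A u) u.

End SelfAdjoint.

Section Semigroups.
Variables (R : realType) (V : normedModType R[i]).

(* Only the values S t with 0 <= t are relevant. *)
Record contraction_semigroup (S : R -> {linear V -> V}) : Prop := {
  semigroup0 : forall u, S 0 u = u ;
  semigroupD : forall s t u, 0 <= s -> 0 <= t -> S (s + t) u = S s (S t u) ;
  semigroup_continuous :
    forall u, {within `[0, +oo[, continuous (fun t => S t u)} ;
  semigroup_contraction : forall t u, 0 <= t -> `|S t u| <= `|u|
}.

Definition is_generator (B : operator V) (S : R -> {linear V -> V}) : Prop :=
  forall u v, (dom B u /\ B u = v) <->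
    (t^-1)%:C *: (S t u - u) @[t --> 0^'+] --> v.

(* S t = exp (- t A): a strongly continuous semigroup is determined by its
   generator. *)
Definition exp_semigroup (A : operator V) (S : R -> {linear V -> V}) : Prop :=
  contraction_semigroup S /\ is_generator (scale_op (-1) A) S.

End Semigroups.

Record intertwining_cocycle (R : realType) (I : Type)
    (H : I -> normedModType R[i]) (S : forall i, R -> {linear H i -> H i})
    (K : forall i j, {linear H j -> H i}) (lambda : I -> I -> R) : Prop := {
  cocycle_bounded : forall i j, bounded_operator (K i j) ;
  cocycle_inj : forall i j, injective (K i j) ;
  cocycle_factor_gt0 : forall i j, 0 < lambda i j ;
  cocycle_comp : forall i j k u, K i k u = K i j (K j k u) ;
  cocycle_intertwine : forall i j t u, 0 <= t ->
    K i j (S j t u) = S i (lambda i j * t) (K i j u)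
}.

(* Main.v *)
Require Import Defs.
From mathcomp Require Import all_boot all_order all_algebra.
From mathcomp Require Import all_classical all_reals all_analysis.

Import Order.TTheory GRing.Theory Num.Theory.
Import numFieldNormedType.Exports.

Local Open Scope classical_set_scope.
Local Open Scope complex_scope.
Local Open Scope ring_scope.

(** Since [K i i] is idempotent and injective, it is the identity, so [K j i]
    is a bounded inverse of [K i j]. Differentiating the intertwining relation
    at [t = 0] shows that [K i j] conjugates [A j] into [lambda i j *: A i],
    whence both operators have the same spectrum. After fixing an index [k0],
    it suffices to take [tau i = lambda i k0]: every [tau i *: A i] is then
    similar to [A k0]. *)

Lemma bounded_operator_ge0 (R : realType) (V W : normedModType R[i])
    (T : V -> W) : bounded_operator T ->
  exists2 M : R, 0 <= M & forall u, `|T u| <= M%:C * `|u|.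
Proof.
move=> [M TM]; exists `|M| => // u; apply: (le_trans (TM u)).
by apply: ler_wpM2r => //; rewrite lecR ler_norm.
Qed.

Lemma bounded_operator_comp (R : realType) (U V W : normedModType R[i])
    (T : V -> W) (T' : U -> V) :
  bounded_operator T -> bounded_operator T' -> bounded_operator (T \o T').
Proof.
move=> /bounded_operator_ge0[M M0 TM] [M' TM']; exists (M * M') => u /=.
apply: (le_trans (TM _)); rewrite rmorphM -mulrA.
by apply: ler_wpM2l; rewrite ?lecR.
Qed.

Lemma bounded_operator_continuous (R : realType) (V W : normedModType R[i])
    (T : {linear V -> W}) : bounded_operator T -> continuous T.
Proof.
move=> /bounded_operator_ge0[M M0 TM]; apply: bounded_linear_continuous.
apply/linear_boundedP; exists (M%:C); split; first by rewrite realE lecR M0.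
move=> r Mr u; apply: (le_trans (TM u)); apply: ler_wpM2r => //.
exact: ltW.
Qed.

Lemma cvg_mull_at_right0 (R : realType) (a : R) :
  0 < a -> a * t @[t --> 0^'+] --> 0^'+.
Proof.
move=> a0 P /= [e /= e0 eP]; exists (e / a) => /=; first exact: divr_gt0.
move=> t /= te t0; apply: eP => /=; last exact: mulr_gt0.
move: te; rewrite !sub0r !normrN normrM (gtr0_norm a0).
by rewrite ltr_pdivlMr// mulrC.
Qed.

(** Continuity lets [K] pass through the limit of the difference quotients of [S] at [u]. Rescaling
    time by [c^-1] turns their images into difference quotients of [S'] at [K u], up to a constant
    factor. *)
Lemma generator_intertwine (R : realType) (V W : normedModType R[i])
    (A : operator V) (B : operator W) (S : R -> {linear V -> V})
    (S' : R -> {linear W -> W}) (K : {linear V -> W}) (c : R) :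
  0 < c -> bounded_operator K -> is_generator A S -> is_generator B S' ->
  (forall t u, 0 <= t -> K (S t u) = S' (c * t) (K u)) ->
  forall u, dom A u -> dom B (K u) /\ c%:C *: B (K u) = K (A u).
Proof.
move=> c0 Kb SA SB KS u Au.
have cC0 : c%:C != 0 :> R[i] by rewrite (inj_eq (@complexI _)) gt_eqF.
have Kc := bounded_operator_continuous _ _ _ _ Kb.
have [+ _] := SA u (A u) => /(_ (conj Au erefl)) Slim.
(* By [SB], this one limit gives both [dom B (K u)] and the value of [B (K u)]. *)
suff /SB[BKu BE] : (t^-1)%:C *: (S' t (K u) - K u) @[t --> 0^'+] -->
    (c^-1)%:C *: K (A u).
  by split=> //; rewrite BE scalerA fmorphV mulfV// scale1r.
have : (c^-1)%:C *: K (((c^-1 * t)^-1)%:C *: (S (c^-1 * t) u - u))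
    @[t --> 0^'+] --> (c^-1)%:C *: K (A u).
  apply: cvgZl_tmp.
  apply: (cvg_comp _ (fun t => K ((t^-1)%:C *: (S t u - u)))
    (cvg_mull_at_right0 _ (c^-1) _)); first by rewrite invr_gt0.
  exact: (cvg_comp _ _ Slim (Kc _)).
(* For [t > 0] the two quotients agree: [S (c^-1 * t)] is carried to [S' t], and
   [c^-1 * (c^-1 * t)^-1 = t^-1]. *)
apply: cvg_trans; apply: near_eq_cvg; near=> t.
have t0 : 0 < t by near: t; exact: nbhs_right_gt.
rewrite linearZ linearB /= KS; last by rewrite mulr_ge0// ?invr_ge0 ltW.
rewrite mulVKf ?gt_eqF// scalerA -rmorphM invfM invrK mulrA mulVf ?gt_eqF//.
by rewrite mul1r.
Unshelve. all: by end_near.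
Qed.

(** If [T] is the resolvent of [A] at [z], then [K \o T \o K'] is that of [B] at [z]; the two domain
    inclusions make the conjugation legitimate for unbounded operators. *)
Lemma resolvent_set_similar (R : realType) (V W : normedModType R[i])
    (A : operator V) (B : operator W) (K : {linear V -> W})
    (K' : {linear W -> V}) :
  bounded_operator K -> bounded_operator K' -> cancel K K' -> cancel K' K ->
  (forall u, dom A u -> dom B (K u) /\ B (K u) = K (A u)) ->
  (forall v, dom B v -> dom A (K' v) /\ A (K' v) = K' (B v)) ->
  resolvent_set A `<=` resolvent_set B.
Proof.
move=> Kb K'b KK' K'K AB BA z [T [Tb Tl Tr]].
exists (K \o T \o K')%FUN; split.
- exact: (bounded_operator_comp _ _ _ _ _ _ (bounded_operator_comp _ _ _ _ _ _ Kb Tb) K'b).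
- move=> v Bv; have [AK'v AE] := BA v Bv.
  by rewrite /= linearB linearZ /= -AE Tl// K'K.
- move=> v /=; have [AT E] := Tr (K' v); have [BKT ->] := AB _ AT.
  by split=> //; rewrite -linearZ -linearB E K'K.
Qed.

Theorem theorem3p4 (R : realType) (I : Type) (H : I -> hilbertType R)
    (A : forall i, operator (H i))
    (S : forall i, R -> {linear H i -> H i})
    (K : forall i j, {linear H j -> H i})
    (lambda : I -> I -> R)
    (H_separable : forall i, separable (H i))
    (A_self_adjoint : forall i, self_adjoint (A i))
    (A_positive : forall i, positive_op (A i))
    (A_compact_resolvent : forall i, has_compact_resolvent (A i))
    (A_nontrivial : forall i, exists mu : R,
      [/\ 0 < mu, spectrum (A i) mu%:C & op_eigenvalue (A i) mu%:C])
    (S_exp : forall i, exp_semigroup (A i) (S i))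
    (K_cocycle : intertwining_cocycle S K lambda) :
  (forall i j, boundedly_invertible (K i j)) /\
  exists tau : I -> R,
    (forall i, 0 < tau i) /\
    (forall i j, spectrum (scale_op (tau i)%:C (A i)) =
                 spectrum (scale_op (tau j)%:C (A j))).
Proof.
have [Kb Kinj l0 KK KS] := K_cocycle.
have Kid i u : K i i u = u by apply: (Kinj i i); rewrite -KK.
have KV i j : cancel (K i j) (K j i) by move=> u; rewrite -KK Kid.
split=> [i j|].
  by exists (K j i); split; [exact: Kb | exact: KV | exact: KV].
have AK i j u : dom (A j) u ->
    dom (A i) (K i j u) /\ (lambda i j)%:C *: A i (K i j u) = K i j (A j u).
  move=> Au; have [_ Sj] := S_exp j; have [_ Si] := S_exp i.
  have [dK E] := generator_intertwine _ _ _ _ _ _ _ _ _ (l0 i j) (Kb i j) Sj Si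
    (KS i j) u Au.
  (* The generators are the operators [- A i], so a sign is cancelled on both sides. *)
  split=> //; move: E; rewrite /= !scaleN1r scalerN linearN.
  exact: oppr_inj.
(* A reference index exists only if [I] is inhabited; over an empty [I] any [tau] works
   vacuously. *)
have [[k0] | I0] := pselect (inhabited I); last first.
  by exists (fun=> 1); split=> // i; case: I0.
exists (fun i => lambda i k0); split=> // i j.
suff specE k : spectrum (scale_op (lambda k k0)%:C (A k)) = spectrum (A k0).
  by rewrite !specE.
(* [AK k0 k] supplies the domain inclusion. The formula comes from [AK k k0] at [K k0 k v], so that
   the factor is [lambda k k0] itself and no relation with [lambda k0 k] has to be proved. *)
have AoE v : dom (A k) v -> dom (A k0) (K k0 k v) /\
    A k0 (K k0 k v) = K k0 k ((lambda k k0)%:C *: A k v).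
  move=> Av; have [Aov _] := AK k0 k v Av; split=> //.
  have [_] := AK k k0 _ Aov; rewrite KV => ->.
  by rewrite KV.
congr (~` _); apply/seteqP; split.
  exact: (resolvent_set_similar _ _ _ (scale_op _ _) (A k0) (K k0 k) (K k k0)
    (Kb _ _) (Kb _ _) (KV _ _) (KV _ _) AoE (AK k k0)).
exact: (resolvent_set_similar _ _ _ (A k0) (scale_op _ _) (K k k0) (K k0 k)
  (Kb _ _) (Kb _ _) (KV _ _) (KV _ _) (AK k k0) AoE).
Qed.
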